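(* (i) For every finite Boolean lattice $\mathbf{B}$, there exists a complementation on the bounded lattice $\mathbf{M}_3\times\mathbf{B}$ such that the resulting lattice with complementation is subdirectly irreducible and belongs to the class $\mathcal{W}$. (ii) There are infinitely many (pairwise non-isomorphic) finite subdirectly irreducible algebras in $\mathcal{W}$.
   Context: A complementation on a bounded lattice $(L,\vee,\wedge,0,1)$ is a map $'\colon L\to L$ such that $a\vee a'=1$ and $a\wedge a'=0$ for all $a\in L$. A lattice with complementation is an algebra $(L,\vee,\wedge,{}',0,1)$ of type $(2,2,1,0,0)$ where $(L,\vee,\wedge,0,1)$ is a bounded lattice and $'$ is a complementation on it. Subdirect irreducibility refers to congruences of this algebra (i.e., lattice congruences compatible with $'$). $\mathcal{W}$ is the class of lattices with complementation satisfying the quasi-identity $(x'\wedge y\approx 0\ \&\ x\wedge y'\approx 0)\Rightarrow x\approx y$. $\mathbf{M}_3$ is the five-element bounded lattice $\{0,1,a_0,a_1,a_2\}$ where $a_0,a_1,a_2$ form an antichain and $a_i\vee a_j=1$, $a_i\wedge a_j=0$ for $i\ne j$. A Boolean lattice is a complemented distributive lattice, regarded as a bounded lattice. *)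

(* Defs.v *)
From HB Require Import structures.
From mathcomp Require Import all_boot all_order.

Set Implicit Arguments.
Unset Strict Implicit.
Unset Printing Implicit Defensive.

Import Order.TTheory.
Local Open Scope order_scope.

Definition complementation (d : Order.disp_t) (L : tbLatticeType d)
    (c : L -> L) : Prop :=
  forall a : L, a `|` c a = \top /\ a `&` c a = \bot.

Record complLattice := ComplLattice {
  cl_disp : Order.disp_t;
  cl_lattice :> tbLatticeType cl_disp;
  cl_compl : cl_lattice -> cl_lattice;
  cl_complP : complementation cl_compl
}.

Arguments cl_compl : clear implicits.

Definition in_W (A : complLattice) : Prop :=
  forall x y : A,
    cl_compl A x `&` y = \bot -> x `&` cl_compl A y = \bot -> x = y.

Record congruence (A : complLattice) (R : A -> A -> Prop) : Prop := Congruence {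
  cong_refl : forall x, R x x;
  cong_sym : forall x y, R x y -> R y x;
  cong_trans : forall x y z, R x y -> R y z -> R x z;
  cong_join : forall x1 y1 x2 y2,
    R x1 y1 -> R x2 y2 -> R (x1 `|` x2) (y1 `|` y2);
  cong_meet : forall x1 y1 x2 y2,
    R x1 y1 -> R x2 y2 -> R (x1 `&` x2) (y1 `&` y2);
  cong_compl : forall x y, R x y -> R (cl_compl A x) (cl_compl A y)
}.

Definition nontrivial_congruence (A : complLattice) (R : A -> A -> Prop) : Prop :=
  congruence R /\ exists x y : A, R x y /\ x <> y.

(* There is a least congruence different from equality (the monolith); in
   particular the one-element algebra is not subdirectly irreducible. *)
Definition subdirectly_irreducible (A : complLattice) : Prop :=
  exists2 mu : A -> A -> Prop, nontrivial_congruence mu &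
    forall R : A -> A -> Prop, nontrivial_congruence R ->
      forall x y, mu x y -> R x y.

Definition isomorphic (A B : complLattice) : Prop :=
  exists f : A -> B,
    [/\ bijective f,
        (forall x y, f (x `|` y) = f x `|` f y),
        (forall x y, f (x `&` y) = f x `&` f y),
        (forall x, f (cl_compl A x) = cl_compl B (f x)) &
        f \bot = \bot /\ f \top = \top].

Definition finite_alg (A : complLattice) : Prop :=
  exists s : seq A, forall x : A, x \in s.

Inductive M3 : Type := M3_bot | M3_top | M3_atom of 'I_3.

Definition M3_code (x : M3) : option (option 'I_3) :=
  match x with
  | M3_bot => None
  | M3_top => Some None
  | M3_atom i => Some (Some i)
  end.

Definition M3_decode (u : option (option 'I_3)) : M3 :=
  match u with
  | None => M3_bot
  | Some None => M3_top
  | Some (Some i) => M3_atom i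
  end.

Lemma M3_codeK : cancel M3_code M3_decode.
Proof. by case. Qed.

HB.instance Definition _ := Finite.copy M3 (can_type M3_codeK).

Definition M3_le (x y : M3) : bool :=
  [|| x == M3_bot, y == M3_top | x == y].

Definition M3_meet (x y : M3) : M3 :=
  if M3_le x y then x else if M3_le y x then y else M3_bot.

Definition M3_join (x y : M3) : M3 :=
  if M3_le x y then y else if M3_le y x then x else M3_top.

Lemma M3_eq_atom (i j : 'I_3) : (M3_atom i == M3_atom j) = (i == j).
Proof. by []. Qed.

Lemma M3_le_refl : reflexive M3_le.
Proof. by move=> x; rewrite /M3_le eqxx !orbT. Qed.

Lemma M3_le_anti : antisymmetric M3_le.
Proof.
case=> [||i] [||j] //; rewrite /M3_le M3_eq_atom => /andP[/or3P[]] //.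
by move=> /eqP->.
Qed.

Lemma M3_le_trans : transitive M3_le.
Proof.
case=> [||j] [||i] [||k] //; rewrite /M3_le !M3_eq_atom /=.
by move=> /eqP->.
Qed.

Fact M3_display : Order.disp_t. Proof. exact: Order.Disp tt tt. Qed.

HB.instance Definition _ :=
  Order.Le_isPOrder.Build M3_display M3 M3_le_refl M3_le_anti M3_le_trans.

Lemma M3_lexI (x y z : M3) :
  (x <= M3_meet y z) = (x <= y) && (x <= z).
Proof.
by case: x => [||[[|[|[|//]]] ?]]; case: y => [||[[|[|[|//]]] ?]];
  case: z => [||[[|[|[|//]]] ?]].
Qed.

Lemma M3_leUx (x y z : M3) :
  (M3_join x y <= z) = (x <= z) && (y <= z).
Proof.
by case: x => [||[[|[|[|//]]] ?]]; case: y => [||[[|[|[|//]]] ?]];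
  case: z => [||[[|[|[|//]]] ?]].
Qed.

HB.instance Definition _ := Order.POrder_MeetJoin_isLattice.Build
  M3_display M3 M3_lexI M3_leUx.

Lemma M3_le0x (x : M3) : M3_bot <= x. Proof. by case: x. Qed.

Lemma M3_lex1 (x : M3) : x <= M3_top. Proof. by case: x. Qed.

HB.instance Definition _ := Order.hasBottom.Build M3_display M3 M3_le0x.
HB.instance Definition _ := Order.hasTop.Build M3_display M3 M3_lex1.

Lemma M3_bounds : M3_bot = \bot /\ M3_top = \top.
Proof. by []. Qed.

Lemma M3_atoms (i j : 'I_3) : i != j ->
  M3_atom i `|` M3_atom j = \top /\ M3_atom i `&` M3_atom j = \bot.
Proof.
move=> /negbTE ij; rewrite /Order.join /Order.meet /= /M3_join /M3_meet /M3_le.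
by rewrite !M3_eq_atom /= (eq_sym j) ij.
Qed.

(* Main.v *)
(* On [M3 x B], set [(m, b)' = (f_b(m), ~b)], where [f_b] swaps [0] and [1] and
   permutes the three atoms cyclically, the direction depending on whether
   [b = 0]. A 3-cycle is a tournament on the atoms, which is what [W] requires.
   The change of direction means that no congruence can collapse elements of
   [B] without also collapsing two atoms of the simple lattice [M3]; hence the
   kernel of the projection onto [B] is the monolith. *)
Require Import Defs.
From mathcomp Require Import all_boot all_order.

Set Implicit Arguments.
Unset Strict Implicit.
Unset Printing Implicit Defensive.

Import Order.Theory Order.DefaultSetSubsetOrder.
Local Open Scope order_scope.

Definition M3_rot (s : bool) (x : M3) : M3 :=
  match x with
  | M3_bot => M3_top
  | M3_top => M3_bot
  | M3_atom i => M3_atom (if s then ordS i else ord_pred i)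
  end.

Lemma M3_rotP (s : bool) : complementation (M3_rot s).
Proof.
case=> [||i]; [by split | by split | apply: M3_atoms].
by case: s i => -[[|[|[|//]]] ?].
Qed.

Lemma M3_rotW (s : bool) (x y : M3) :
  M3_rot s x `&` y = \bot -> x `&` M3_rot s y = \bot -> x = y.
Proof.
move=> /eqP + /eqP; case: s x y => -[||[[|[|[|//]]] ?]] [||[[|[|[|//]]] ?]] //;
  by move=> _ _; apply/eqP.
Qed.

(** Two turns of a 3-cycle take an atom to a different atom. *)
Lemma M3_join_rot2 (s : bool) (x : M3) :
  x != \bot -> x `|` M3_rot s (M3_rot s x) = \top.
Proof. by move=> x0; apply/eqP; case: s x x0 => -[||[[|[|[|//]]] ?]]. Qed.

(** Write [x'] for [M3_rot true x]. By [M3_rotW], distinct [x] and [y] make [x' & y] or [y' & x]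
    nonzero, so meeting the pair with [x'] or [y'] relates 0 to some nonzero [p]. *)
Lemma M3_simple (S : M3 -> M3 -> Prop) :
    (forall x, S x x) -> (forall x y, S x y -> S y x) ->
    (forall x1 y1 x2 y2, S x1 y1 -> S x2 y2 -> S (x1 `|` x2) (y1 `|` y2)) ->
    (forall x1 y1 x2 y2, S x1 y1 -> S x2 y2 -> S (x1 `&` x2) (y1 `&` y2)) ->
  forall x y, S x y -> x <> y -> S \bot \top.
Proof.
move=> Srefl Ssym Sjoin Smeet.
have S0 p : S \bot p -> p != \bot -> S \bot \top.
  move=> Sp p0.
  (* Joining [(0, p)] with [p'] gives [(p', 1)]; meeting with [p''] gives [(0, p'')]; a join with
     [(0, p)] then reaches 1. *)
  have := Smeet _ _ _ _ (Sjoin _ _ _ _ Sp (Srefl (M3_rot true p)))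
    (Srefl (M3_rot true (M3_rot true p))).
  rewrite join0x !(M3_rotP true _).1 !(M3_rotP true _).2 meet1x => S2.
  by have := Sjoin _ _ _ _ Sp S2; rewrite joinxx M3_join_rot2.
have S1 x y : S x y -> M3_rot true x `&` y != \bot -> S \bot \top.
  move=> Sxy; apply: S0.
  by rewrite -(M3_rotP true x).2 meetC; apply: Smeet.
move=> x y Sxy nxy.
have [xy0|] := eqVneq (M3_rot true x `&` y) \bot; last exact: S1.
have [yx0|] := eqVneq (M3_rot true y `&` x) \bot; last exact/S1/Ssym.
by case: nxy; apply: (@M3_rotW true) => //; rewrite meetC.
Qed.

Section Twist.
Variables (d : Order.disp_t) (B : ctbDistrLatticeType d).

Definition twist (x : M3 *p B) : M3 *p B :=
  (M3_rot (x.2 == \bot) x.1, ~` x.2).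

Lemma twistP : complementation twist.
Proof.
case=> m b; rewrite joinEprod meetEprod /= joinxC meetxC.
by have [-> ->] := M3_rotP (b == \bot) m.
Qed.

Definition twisted : complLattice := ComplLattice twistP.

Lemma compl_disjoint_eq (b e : B) :
  ~` b `&` e = \bot -> b `&` ~` e = \bot -> b = e.
Proof.
move=> be eb; apply/le_anti.
by rewrite -!diff_eq0 !diffE eb meetC be eqxx.
Qed.

Lemma twisted_W : in_W twisted.
Proof.
move=> [m b] [k e] /=; rewrite /twist !meetEprod /= => -[mk be] [km eb].
move: mk km; rewrite (compl_disjoint_eq be eb) => mk km.
by rewrite (M3_rotW mk km).
Qed.

Section Congruence.
Variables (R : M3 *p B -> M3 *p B -> Prop).
Hypothesis congR : @congruence twisted R.

Lemma cong_fst (m k : M3) (b : B) :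
  R (m, b) (k, b) -> m <> k -> R (\bot, \bot) (\top, \bot).
Proof.
have [Rrefl Rsym _ Rjoin Rmeet _] := congR.
(* Meeting with [(1, 0)] moves the pair to the fiber over 0, a copy of the simple lattice [M3]. *)
move=> Rmk; apply: (@M3_simple (fun x y => R (x, \bot) (y, \bot)) _ _ _ _ m k).
- by [].
- by move=> x y /Rsym.
- by move=> x1 y1 x2 y2 h1 /(Rjoin _ _ _ _ h1); rewrite !joinEprod /= joinxx.
- by move=> x1 y1 x2 y2 h1 /(Rmeet _ _ _ _ h1); rewrite !meetEprod /= meetxx.
- have := Rmeet _ _ _ _ Rmk (Rrefl (\top, \bot)).
  by rewrite !meetEprod /= !meetx1 meetx0.
Qed.

(* An atom of [M3] turns one way over [0] and the other way over [b], so a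
   congruence identifying [(0, 0)] and [(0, b)] also identifies two distinct
   elements with the same second component. *)
Lemma cong_snd (b : B) :
  R (\bot, \bot) (\bot, b) -> b != \bot -> R (\bot, \bot) (\top, \bot).
Proof.
have [Rrefl _ _ Rjoin Rmeet Rc] := congR.
move=> R0b b0.
have := Rjoin _ _ _ _ R0b (Rrefl (M3_atom ord0, \bot)).
rewrite !joinEprod /= !joinx0 !join0x => /Rc/Rmeet/(_ (Rrefl (\top, \bot))).
rewrite /= /twist !meetEprod /= eqxx (negbTE b0) !meetx1 !meetx0.
by move/cong_fst; apply=> /eqP.
Qed.

Lemma cong_fiber (x y : M3 *p B) :
  R x y -> x <> y -> R (\bot, \bot) (\top, \bot).
Proof.
have [Rrefl Rsym _ _ Rmeet _] := congR.
(* Meeting with [(0, ~e)] erases the first components and turns [e] into 0, but leaves [b] minus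
   [e], which is nonzero; so [cong_snd] applies. *)
have Rdiff m k b e : R (m, b) (k, e) -> ~~ (b <= e) ->
    R (\bot, \bot) (\top, \bot).
  move=> Rbe nbe; apply: (@cong_snd (b `&` ~` e)).
    apply: Rsym.
    have := Rmeet _ _ _ _ Rbe (Rrefl (\bot, ~` e)).
    by rewrite !meetEprod /= !meetx0 meetxC.
  by rewrite -diffE diff_eq0.
case: x y => m b [k e] Rxy nxy.
have [be|] := boolP (b <= e); last exact: Rdiff Rxy.
have [eb|] := boolP (e <= b); last exact/Rdiff/Rsym/Rxy.
have {be eb} be : b = e by apply/le_anti/andP.
by subst e; apply: (cong_fst Rxy) => mk; rewrite mk in nxy.
Qed.

End Congruence.

Lemma twisted_SI : subdirectly_irreducible twisted.
Proof.
exists (fun x y => x.2 = y.2).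
  split; last by exists (\bot, \bot), (\top, \bot).
  split=> //.
  - by move=> x y z ->.
  - by move=> x1 y1 x2 y2 h1 h2; rewrite !joinEprod /= h1 h2.
  - by move=> x1 y1 x2 y2 h1 h2; rewrite !meetEprod /= h1 h2.
  - by move=> x y /= ->.
move=> R [congR [x [y [Rxy nxy]]]] [m b] [k e] /= <-.
have R01 := cong_fiber congR Rxy nxy.
have [Rrefl Rsym Rtrans Rjoin _ _] := congR.
(* Joining with [(p, b)] transports the collapse of the fiber over 0 to the fiber over [b]. *)
have R1 p : R (p, b) (\top, b).
  have := Rjoin _ _ _ _ R01 (Rrefl (p, b)).
  by rewrite !joinEprod /= !join0x join1x.
exact/(Rtrans _ _ _ (R1 m))/Rsym.
Qed.

End Twist.

Theorem corollary3p4 :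
  (forall (d : Order.disp_t) (B : finCTBDistrLatticeType d),
     exists (c : M3 *p B -> M3 *p B) (cP : complementation c),
       subdirectly_irreducible (ComplLattice cP) /\ in_W (ComplLattice cP)) /\
  (exists A : nat -> complLattice,
     (forall n : nat,
        [/\ finite_alg (A n), subdirectly_irreducible (A n) & in_W (A n)]) /\
     (forall m n : nat, isomorphic (A m) (A n) -> m = n)).
Proof.
split=> [d B|].
  exists (@twist d B), (@twistP d B); split; [exact: twisted_SI | exact: twisted_W].
(* The algebra over the subsets of an [n]-element set has [5 * 2^n] elements, so cardinality
   determines [n]. *)
exists (fun n => twisted {set 'I_n}).
split=> [n|m n [f [bij_f _ _ _ _]]].
  split; [|exact: twisted_SI|exact: twisted_W].
  by exists (enum {: M3 * {set 'I_n}}) => x; rewrite mem_enum.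
have := @bij_eq_card (M3 * {set 'I_m})%type (M3 * {set 'I_n})%type f bij_f.
rewrite !card_prod -!cardsT -!powersetT !card_powerset !cardsT !card_ord => /eqP.
rewrite eqn_pmul2l ?cardsT; last by apply/card_gt0P; exists M3_bot.
by rewrite eqn_exp2l // => /eqP.
Qed.
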